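(* Let $K$ be a field of characteristic $p>0$, $\lambda:=\log_2\left(p-\tfrac12\right)$, $q\in\mathbb N$, $\kappa>0$ real, and let $L=L(\Theta,\bar S)$ be a 3-generated restricted Lie algebra associated with a species of flies $\Theta$ and a tuple $\bar S$ with the following properties. (a) For any $\epsilon,\delta>0$ there are infinitely many $n$ with $\exp\big(\frac{n}{(\ln n)^{\lambda+\epsilon}}\big)\le\gamma_L(n)\le\exp\big(\delta\frac{n}{(\ln n)^{\lambda}}\big)$. (b) For any $\epsilon>0$ there are infinitely many $n$ with $n(\ln^{(q)}n)^{\kappa-\epsilon}\le\gamma_L(n)\le n(\ln^{(q)}n)^{\kappa+\epsilon}$. (c) $L$ has intermediate growth, and for any $\epsilon,\delta>0$ there is $n_0$ with $n(\ln^{(q)}n)^{\kappa-\epsilon}\le\gamma_L(n)\le\exp\big(\delta\frac{n}{(\ln n)^{\lambda}}\big)$ for all $n\ge n_0$. (d) The $p$-mapping of $L$ is nil. Then: (i) $\mathrm{Dim}^4L=1/\lambda=\log_{p-1/2}(2)$; (ii) $\underline{\mathrm{Dim}}^2L=1$ (i.e. the lower Gelfand–Kirillov dimension of $L$ is $1$); (iii) more precisely, $\underline{\mathrm{Ldim}}^qL=\kappa$.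
   Context: Species of flies. Fix $k\ge3$ and an alphabet $\Theta_0=\{1,\dots,k\}$. A species of flies $\Theta=\bigcup_{n\ge0}\Theta_n$ is a set of words over $\Theta_0$ such that $\Theta_{n+1}\subset\{ab\mid a,b\in\Theta_n,\ a\ne b\}$ (concatenation of words) for all $n\ge0$; it is always assumed that $|\Theta_n|\ge3$ for all $n\ge0$. Elements of $\Theta_n$ are called flies of generation $n$. Drosophila Lie algebras. Let $K$ be a field of characteristic $p>0$, $\Theta$ a species of flies, and $\bar S=(S_a)_{a\in\Theta}$ a tuple of positive integers. $R=R(\Theta,\bar S)$ is the commutative associative divided power $K$-algebra with basis the formal products $\prod_{a\in\Theta}t_a^{(i_a)}$, $0\le i_a<p^{S_a}$, only finitely many $i_a$ nonzero, with $t_a^{(0)}=1$ and multiplication $t_a^{(i)}t_a^{(j)}=\binom{i+j}{i}t_a^{(i+j)}$ (which is $0$ if $i+j\ge p^{S_a}$) in each variable separately. $\partial_a$ is the derivation of $R$ with $\partial_a(t_a^{(i)})=t_a^{(i-1)}$ ($t_a^{(l)}=0$ for $l<0$) and $\partial_a(t_b^{(i)})=0$ for $b\ne a$. The virtual pivot elements $v_a\in\mathrm{Der}\,R$, $a\in\Theta$, are defined recursively by $$v_a=\partial_a+t_a^{(p^{S_a}-1)}\sum_{b\in\Theta_n,\ ab\in\Theta_{n+1}}t_b^{(p^{S_b}-1)}v_{ab},\qquad a\in\Theta_n,\ n\ge0,$$ i.e. by infinite iteration of this recursion; the resulting infinite sums act on $R$ because only finitely many summands act nontrivially on any given element. $L(\Theta,\bar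 S):=\mathrm{Lie}_p(v_1,\dots,v_k)$ is the restricted Lie subalgebra of $\mathrm{Der}\,R$ (bracket $[x,y]=xy-yx$, $p$-mapping $x^{[p]}=x^p$) generated by $v_1,\dots,v_k$. Here ''3-generated'' corresponds to $k=3$. Growth. For a restricted Lie algebra $L$ generated by a finite set $X$, $\gamma_L(n)=\gamma_L(X,n)$ is the dimension of the span of all $[x_{i_1},\dots,x_{i_s}]^{p^l}$ with $x_{i_j}\in X$, $l\ge0$, $sp^l\le n$ (right-normed commutators). For $L(\Theta,\bar S)$ take $X=\{v_1,\dots,v_k\}$. Intermediate growth means subexponential growth which is not bounded by a polynomial. The $p$-mapping is nil if for every $x\in L$ there is $N$ with $x^{p^N}=0$. Notation. $\ln^{(1)}n=\ln n$, $\ln^{(q+1)}n=\ln(\ln^{(q)}n)$; where $\ln^{(q)}n$ is undefined, negative or less than $1$, it is redefined to be $1$. For increasing functions $f,g:\mathbb N\to\mathbb R^+$ write $f\preccurlyeq g$ if there are positive constants $N,C$ with $f(n)\le g(Cn)$ for all $n\ge N$. Dimensions. For real $\alpha>0$: $\Phi^2_\alpha(n)=n^\alpha$ and $\Phi^4_\alpha(n)=\exp\big(n/(\ln n)^{1/\alpha}\big)$. For $s\in\{2,4\}$: $\mathrm{Dim}^sA=\inf\{\alpha>0\mid\exists N:\ \gamma_A(n)\le\Phi^s_\alpha(n),\ n\ge N\}$ and $\underline{\mathrm{Dim}}^sA=\sup\{\alpha>0\mid\exists N:\ \gamma_A(n)\ge\Phi^s_\alpha(n),\ n\ge N\}$.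 For $q\in\mathbb N$: $\underline{\mathrm{Ldim}}^qA=\sup\{\beta>0\mid\gamma_A(n)\succcurlyeq n(\ln^{(q)}n)^\beta\}$. *)

(* Defs.v *)
From HB Require Import structures.
From mathcomp Require Import all_boot all_order all_algebra finmap.
From mathcomp Require Import all_classical all_reals all_analysis.
(* The notations of monalg are incompatible with those of MathComp-Analysis. *)
From mathcomp Require Import -(notations) monalg.

Set Implicit Arguments.
Unset Strict Implicit.
Unset Printing Implicit Defensive.

Import Order.TTheory GRing.Theory Num.Theory.
Import numFieldNormedType.Exports.

Local Open Scope classical_set_scope.
Local Open Scope ring_scope.

Section LinearAlgebra.
Variables (K : fieldType) (V : lmodType K).

Definition is_subspace (W : set V) : Prop :=
  [/\ W 0, forall x y, W x -> W y -> W (x + y) &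
      forall (c : K) x, W x -> W (c *: x)].

Definition lspan (A : set V) : set V := smallest is_subspace A.

Definition lin_indep (d : nat) (b : 'I_d -> V) : Prop :=
  forall c : 'I_d -> K, \sum_(i < d) c i *: b i = 0 -> forall i, c i = 0.

Definition is_basis (W : set V) (d : nat) (b : 'I_d -> V) : Prop :=
  lin_indep b /\ lspan (range b) = W.

(* Meaningful for finite-dimensional W only: the value is 0 if W has no finite
   basis. *)
Definition ldim (W : set V) : nat :=
  xget 0%N [set d : nat | exists b : 'I_d -> V, is_basis W b].

End LinearAlgebra.

(* Operators are bare functions with the pointwise linear structure; the
   algebras considered below are generated by linear maps and so consist of
   linear maps. *)
Section RestrictedLie.
Variables (K : fieldType) (p : nat) (V : lmodType K).

Definition lie_br (x y : V -> V) : V -> V := x \o y - y \o x.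

Definition op_pow (x : V -> V) (m : nat) : V -> V := fun f => iter m x f.

Definition is_restricted_lie (W : set (V -> V)) : Prop :=
  [/\ is_subspace W,
      forall x y, W x -> W y -> W (lie_br x y) &
      forall x, W x -> W (op_pow x p)].

Definition lie_p (X : set (V -> V)) : set (V -> V) :=
  smallest is_restricted_lie X.

Fixpoint rnorm_comm (x : V -> V) (s : seq (V -> V)) : V -> V :=
  if s is y :: s' then lie_br x (rnorm_comm y s') else x.

Definition growth_set (J : Type) (x : J -> V -> V) (n : nat) : set (V -> V) :=
  [set z | exists (j : J) (s : seq J) (l : nat),
     ((size s).+1 * p ^ l <= n)%N /\
     z = op_pow (rnorm_comm (x j) (map x s)) (p ^ l)].

Definition growth (J : Type) (x : J -> V -> V) (n : nat) : nat :=
  ldim (lspan (growth_set x n)).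

Definition p_nil (L : set (V -> V)) : Prop :=
  forall x, L x -> exists N : nat, op_pow x (p ^ N) = 0.

End RestrictedLie.

Section DividedPowers.
Variables (K : fieldType) (p : nat) (I : choiceType) (S : I -> nat).

Definition dp_bounded (i : {fsfun I -> nat with 0%N}) : bool :=
  all (fun a => i a < p ^ S a)%N (finsupp i).

(* DPExp i stands for the formal product of the t_a^(i a). *)
Record dpexp := DPExp { dpval :> {fsfun I -> nat with 0%N};
                        _ : dp_bounded dpval }.

HB.instance Definition _ := [isSub for dpval].
HB.instance Definition _ := [Choice of dpexp by <:].

Definition dpalg : Type := malg dpexp K.

HB.instance Definition _ := GRing.Lmodule.on dpalg.

(* Exponents outside of the allowed range give 0. *)
Definition dpmon (i : {fsfun I -> nat with 0%N}) : dpalg :=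
  if insub i is Some m then mkmalgU (m : dpexp) 1 else 0.

Definition dpvar (a : I) (n : nat) : dpalg :=
  dpmon [fsfun [fsfun] with a |-> n].

Definition dpmul (f g : dpalg) : dpalg :=
  \sum_(i <- msupp f) \sum_(j <- msupp g)
    (mcoeff i f * mcoeff j g *
     (\prod_(a <- (finsupp i `|` finsupp j)%fset) 'C(i a + j a, i a))%N%:R) *:
    dpmon [fsfun a in (finsupp i `|` finsupp j)%fset => (i a + j a)%N].

Definition dpderiv (a : I) (f : dpalg) : dpalg :=
  \sum_(i <- msupp f)
    mcoeff i f *: (if i a == 0%N then 0
                   else dpmon [fsfun (i : {fsfun _ -> _ with _})
                                 with a |-> (i a).-1]).

End DividedPowers.

(* Words over {1, ..., k} are sequences over 'I_k.  Words of generation n have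
   length 2 ^ n, so that distinct generations are disjoint. *)
Record species (k : nat) := Species {
  generation :> nat -> {fset seq 'I_k};
  generation0 : generation 0 = [fset [:: i] | i in 'I_k]%fset;
  generationS : forall n w, w \in generation n.+1 ->
    exists a b, [/\ a \in generation n, b \in generation n, a != b
                  & w = a ++ b];
  generation_ge3 : forall n, (3 <= #|` generation n|)%N }.

Definition fly (k : nat) (Theta : species k) : choiceType :=
  {n : nat & Theta n}.

Section Drosophila.
Variables (K : fieldType) (p k : nat) (Theta : species k).
Variable S : fly Theta -> nat.

Local Notation R := (dpalg K p S).

Definition to_fly n (a : Theta n) : fly Theta := Tagged (fun n => Theta n) a.

Definition hybrid n (a b : Theta n) : option (Theta n.+1) :=
  insub (val a ++ val b).

Definition top_power n (a : Theta n) : R :=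
  dpvar K p S (to_fly a) (p ^ S (to_fly a)).-1.

(* The recursion for v_a: D stands for the family of the v_c, c of generation
   n.+1. *)
Definition pivot_step n (D : Theta n.+1 -> R -> R) (a : Theta n) (f : R) : R :=
  dpderiv (to_fly a) f +
  dpmul (top_power a)
    (\sum_(b : Theta n)
       if hybrid a b is Some c then dpmul (top_power b) (D c f) else 0).

(* m iterations of the recursion, the generations from n + m on being
   discarded. *)
Fixpoint pivot_iter (m n : nat) : Theta n -> R -> R :=
  if m is m'.+1 then pivot_step (pivot_iter m' (n := n.+1)) else fun _ _ => 0.

Definition max_generation (f : R) : nat :=
  \max_(i <- msupp f) \max_(a <- finsupp i) tag a.

(* The summands involving a derivation of generation > max_generation f kill
   f. *)
Definition pivot n (a : Theta n) (f : R) : R :=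
  pivot_iter (max_generation f).+1 a f.

(* The closure is taken among all operators on R: Der R is itself closed under
   linear combinations, brackets and p-th powers and contains the v_a. *)
Definition drosophila : set (R -> R) := lie_p p (range (@pivot 0)).

Definition drosophila_growth (n : nat) : nat := growth p (@pivot 0) n.

Lemma dpmul0 (f : R) : dpmul f 0 = 0.
Proof.
rewrite /dpmul big1// => i _.
by rewrite [msupp _](_ : _ = fset0) ?big_nil//; exact: msupp0.
Qed.

Lemma dpderiv_gen n (a : Theta n) (f : R) :
  (max_generation f < n)%N -> dpderiv (to_fly a) f = 0.
Proof.
move=> ltn; rewrite /dpderiv big_seq big1// => i fi.
case: ifP => [|/negbT ia]; first by rewrite scaler0.
have : (n <= max_generation f)%N.
  rewrite /max_generation (big_rem i fi)/= leq_max; apply/orP; left.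
  have ia' : to_fly a \in finsupp i by rewrite mem_finsupp.
  by rewrite (big_rem _ ia')/= leq_max leqnn.
by rewrite leqNgt ltn.
Qed.

Lemma eq_pivot_step n (D D' : Theta n.+1 -> R -> R) (a : Theta n) (f : R) :
  (forall c, D c f = D' c f) -> pivot_step D a f = pivot_step D' a f.
Proof.
move=> DD'; rewrite /pivot_step.
apply: (f_equal (fun u => _ + dpmul _ u)).
by apply: eq_bigr => b _; case: hybrid => [c|]; [rewrite DD'|].
Qed.

Lemma pivot_iter_gen m n (a : Theta n) (f : R) :
  (max_generation f < n)%N -> pivot_iter m a f = 0.
Proof.
elim: m n a => //= m IH n a ltn.
rewrite /pivot_step dpderiv_gen// add0r big1 ?dpmul0// => b _.
by case: hybrid => // c; rewrite IH ?dpmul0// ltnW.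
Qed.

Lemma pivot_iter_stable m1 m2 n (a : Theta n) (f : R) :
  (max_generation f < n + m1)%N -> (max_generation f < n + m2)%N ->
  pivot_iter m1 a f = pivot_iter m2 a f.
Proof.
elim: m1 m2 n a => [|m1 IH] [|m2] n a; rewrite ?addn0 => h1 h2.
- by [].
- by rewrite !pivot_iter_gen.
- by rewrite !pivot_iter_gen.
- by apply: eq_pivot_step => c; apply: IH; rewrite addSnnS.
Qed.

Lemma pivotE n (a : Theta n) (f : R) :
  pivot a f = pivot_step (@pivot n.+1) a f.
Proof.
apply: eq_pivot_step => c.
apply: pivot_iter_stable; rewrite addSn ltnS ?leq_addl//.
by rewrite addnS ltnW// ltnS leq_addl.
Qed.

End Drosophila.

Arguments drosophila K p {k Theta} S.
Arguments drosophila_growth K p {k Theta} S n.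

Section Growth.
Variable R : realType.

Definition logb (b x : R) : R := ln x / ln b.

(* The convention that values which are undefined, negative or less than 1 are
   replaced by 1 is enforced at every step. *)
Definition iter_ln (q n : nat) : R :=
  iter q (fun x => Num.max 1 (ln x)) n%:R.

Definition preceq (f g : nat -> R) : Prop :=
  exists N C : nat, [/\ (0 < N)%N, (0 < C)%N &
    forall n, (N <= n)%N -> f n <= g (C * n)%N].

Definition subexponential (gamma : nat -> R) : Prop :=
  gamma n `^ (n%:R)^-1 @[n --> \oo] --> (1 : R).

Definition polynomially_bounded (gamma : nat -> R) : Prop :=
  exists P : {poly R}, forall n : nat, gamma n <= P.[n%:R].

Definition intermediate_growth (gamma : nat -> R) : Prop :=
  subexponential gamma /\ ~ polynomially_bounded gamma.

Definition Phi2 (alpha : R) (n : nat) : R := n%:R `^ alpha.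

Definition Phi4 (alpha : R) (n : nat) : R :=
  expR (n%:R / (ln n%:R) `^ alpha^-1).

(* Extended reals: the infimum of an empty set is +oo, its supremum -oo. *)
Definition upper_Dim (Phi : R -> nat -> R) (gamma : nat -> R) : \bar R :=
  ereal_inf [set alpha%:E | alpha in [set alpha : R | 0 < alpha /\
    exists N : nat, forall n, (N <= n)%N -> gamma n <= Phi alpha n]].

Definition lower_Dim (Phi : R -> nat -> R) (gamma : nat -> R) : \bar R :=
  ereal_sup [set alpha%:E | alpha in [set alpha : R | 0 < alpha /\
    exists N : nat, forall n, (N <= n)%N -> gamma n >= Phi alpha n]].

Definition lower_Ldim (q : nat) (gamma : nat -> R) : \bar R :=
  ereal_sup [set beta%:E | beta in [set beta : R | 0 < beta /\
    preceq (fun n => n%:R * iter_ln q n `^ beta) gamma]].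

End Growth.

(* Main.v *)
Require Import Defs.
From HB Require Import structures.
From mathcomp Require Import all_boot all_order all_algebra finmap.
From mathcomp Require Import all_classical all_reals all_analysis.
From mathcomp Require Import ring lra.

Import Order.TTheory GRing.Theory Num.Theory.
Import numFieldNormedType.Exports.

Local Open Scope classical_set_scope.
Local Open Scope ring_scope.

(** Each of the three dimensions is an infimum or a supremum of exponents whose
    comparison function bounds the growth eventually.  A bound valid for all
    large n puts exponents into such a set; a bound valid for infinitely many n,
    of order strictly between two comparison functions, keeps exponents out.

    (i) The upper bound in (c) with delta = 1 puts 1 / lambda into the set.
    If alpha < 1 / lambda were in it, then the lower bound in (a), with
    lambda + eps half-way between lambda and 1 / alpha, would contradict it at
    some n with ln n > 1.

    (ii) The lower bound in (c) with eps = kappa gives growth at least n.  An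
    exponent alpha > 1 would give n^(alpha - 1) <= (ln^(q) n)^(2 kappa) for
    infinitely many n by (b), although every power of a logarithm is
    eventually below every positive power of n ([iter_ln_powR_lt]).

    (iii) Exponents beta < kappa are allowed by (c).  Suppose that beta > kappa
    and n (ln^(q) n)^beta <= gamma(C n) for large n.  By (b) there are
    infinitely many m with gamma(m) <= m (ln^(q) m)^(kappa + eps), but such an
    m need not be a multiple of C.  Put n = floor(m / C), so that
    C n <= m <= 2 C n.  As gamma is nondecreasing ([growth_homo]) and
    rescaling the argument by D costs a factor of at most D in the iterated
    logarithm ([iter_lnM_le]), the term (ln^(q) n)^(beta - kappa - eps) stays
    bounded along these n, while ln^(q) n tends to infinity
    ([iter_ln_near_ge]).

    The growth is nondecreasing because it counts dimensions of an increasing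
    chain of subspaces.  The dimension is 0 by convention on subspaces without
    a finite basis, so this needs the spanning sets to be finite
    ([finite_growth_set]) and the Steinitz exchange bound
    ([lin_indep_leq]). *)

(** * Dimension of finitely spanned subspaces *)

Section FiniteDimension.
Context {K : fieldType} {V : lmodType K}.
Implicit Types (A W : set V).

Lemma lspan_subspace A : is_subspace (lspan A).
Proof.
split=> [B [[B0 _ _] _]//|x y Ax Ay B AB|c x Ax B AB].
- by case: (AB) => -[_ BD _] _; apply: BD; [exact: Ax|exact: Ay].
- by case: (AB) => -[_ _ BZ] _; apply: BZ; exact: Ax.
Qed.

Lemma lspan_min A W : is_subspace W -> A `<=` W -> lspan A `<=` W.
Proof. exact: smallest_sub. Qed.

Lemma subset_lspan A : A `<=` lspan A.
Proof. exact: sub_gen_smallest. Qed.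

Lemma subspace_sum W (I : finType) (c : I -> K) (b : I -> V) :
  is_subspace W -> (forall i, W (b i)) -> W (\sum_i c i *: b i).
Proof.
by move=> [W0 WD WZ] Wb; elim/big_ind: _ => // i _; apply: WZ.
Qed.

Lemma lspan_rangeP (I : finType) (b : I -> V) x :
  lspan (range b) x -> exists c : I -> K, x = \sum_i c i *: b i.
Proof.
apply: (@lspan_min _ [set x | exists c : I -> K, x = \sum_i c i *: b i]).
  split=> [|_ _ [c ->] [c' ->]|k _ [c ->]] /=.
  - by exists (fun=> 0); rewrite big1// => i _; rewrite scale0r.
  - exists (fun i => c i + c' i); rewrite -big_split/=.
    by apply: eq_bigr => i _; rewrite scalerDl.
  - exists (fun i => k * c i); rewrite scaler_sumr.
    by apply: eq_bigr => i _; rewrite scalerA.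
move=> _ [i _ <-] /=; exists (fun j => (j == i)%:R).
rewrite (bigD1 i)//= eqxx scale1r big1 ?addr0// => j /negPf ->.
by rewrite scale0r.
Qed.

(** Steinitz bound.  If d > e, the d x e matrix expressing b through c has a
    nonzero row vector in its left kernel, which is a linear relation on b. *)
Lemma lin_indep_leq (d e : nat) (b : 'I_d -> V) (c : 'I_e -> V) :
  lin_indep b -> (forall i, lspan (range c) (b i)) -> (d <= e)%N.
Proof.
move=> indb bc; have /choice[f fE] := fun i => lspan_rangeP _ _ _ (bc i).
pose M := \matrix_(i, j) f i j.
rewrite leqNgt; apply/negP => ed.
have /rowV0Pn[v vM v0] : kermx M != 0.
  by rewrite -mxrank_eq0 mxrank_ker subn_eq0 -ltnNge (leq_ltn_trans (rank_leq_col _)).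
have {}vM : v *m M = 0 by apply/sub_kermxP.
suff : v = 0 by move/eqP: v0.
apply/rowP => i; rewrite mxE; move: i; apply: indb.
transitivity (\sum_j (v *m M) 0 j *: c j); last first.
  by rewrite vM big1// => j _; rewrite mxE scale0r.
under eq_bigr do rewrite fE scaler_sumr.
rewrite exchange_big/=; apply: eq_bigr => j _.
rewrite mxE scaler_suml; apply: eq_bigr => i _.
by rewrite mxE scalerA.
Qed.

Definition extend_family (d : nat) (b : 'I_d -> V) (x : V) : 'I_d.+1 -> V :=
  fun i => if unlift ord0 i is Some j then b j else x.

Lemma lin_indep_extend (d : nat) (b : 'I_d -> V) x :
  lin_indep b -> ~ lspan (range b) x -> lin_indep (extend_family d b x).
Proof.
move=> indb nbx c; rewrite big_ord_recl /extend_family unlift_none.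
under eq_bigr do rewrite liftK.
move=> sum0.
have c0 : c ord0 = 0.
  apply: contra_notP nbx => /eqP c0.
  have -> : x = \sum_i (- (c ord0)^-1 * c (lift ord0 i)) *: b i.
    apply: (scalerI c0); rewrite scaler_sumr.
    under eq_bigr do rewrite scalerA mulrA mulrN divff// mulN1r scaleNr.
    by rewrite sumrN; apply/eqP; rewrite -subr_eq0 opprK sum0.
  apply: subspace_sum; first exact: lspan_subspace.
  by move=> i; apply: subset_lspan; exists i.
move=> i; case: (unliftP ord0 i) => [j|] -> //.
move: j; apply: indb; move: sum0.
by rewrite c0 scale0r add0r.
Qed.

(** A linearly independent family in W of maximal size is a basis, since any
    vector outside of its span would extend it; the spanning family c bounds
    the size. *)
Lemma ldimP W (e : nat) (c : 'I_e -> V) :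
  is_subspace W -> W `<=` lspan (range c) ->
  exists b : 'I_(ldim W) -> V, is_basis W b.
Proof.
move=> subW Wc.
pose P d := `[< exists b : 'I_d -> V, lin_indep b /\ (forall i, W (b i)) >].
have P0 : exists d, P d.
  exists 0%N; apply/asboolP.
  by exists (fun=> 0); split=> [? ?|]; case.
have Pe d : P d -> (d <= e)%N.
  move=> /asboolP[b [indb Wb]]; apply: (lin_indep_leq _ _ b c indb) => i.
  by apply: Wc; exact: Wb.
have [d /asboolP[b [indb Wb]] dmax] := ex_maxnP P0 Pe.
have bas : is_basis W b.
  split=> //; apply/seteqP; split=> [|x Wx].
    by apply: lspan_min => // _ [i _ <-].
  apply: contrapT => nbx; suff /dmax : P d.+1 by rewrite ltnn.
  apply/asboolP; exists (extend_family d b x).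
  split; first exact: lin_indep_extend.
  by move=> i; rewrite /extend_family; case: unlift.
exact: (@xgetPex _ 0%N [set d | exists b : 'I_d -> V, is_basis W b]
  (ex_intro _ d (ex_intro _ b bas))).
Qed.

Lemma ldim_le W W' (e : nat) (c : 'I_e -> V) :
  is_subspace W -> is_subspace W' -> W `<=` W' -> W' `<=` lspan (range c) ->
  (ldim W <= ldim W')%N.
Proof.
move=> sW sW' WW' W'c.
have [b [indb bE]] := ldimP W e c sW (subset_trans WW' W'c).
have [b' [_ b'E]] := ldimP W' e c sW' W'c.
apply: (lin_indep_leq _ _ b b' indb) => i.
rewrite b'E; apply: WW'; rewrite -bE.
by apply: subset_lspan; exists i.
Qed.

Lemma ldim_lspan_le A A' : finite_set A' -> A `<=` A' ->
  (ldim (lspan A) <= ldim (lspan A'))%N.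
Proof.
move=> /finite_seqP[s ->] As.
apply: (ldim_le _ _ (size s) (fun i => tnth (in_tuple s) i)).
- exact: lspan_subspace.
- exact: lspan_subspace.
- apply: lspan_min; first exact: lspan_subspace.
  exact: (subset_trans As (@subset_lspan _)).
- apply: lspan_min; first exact: lspan_subspace.
  move=> x /= xs; apply: subset_lspan.
  have /tnthP[i ->] : x \in in_tuple s by [].
  by exists i.
Qed.

End FiniteDimension.

(** * Monotonicity of the growth function *)

Section Growth.
Context {K : fieldType} {V : lmodType K}.

(** The size of s and the exponent l are both at most n, the latter because
    l < p ^ l. *)
Lemma finite_growth_set (p : nat) (J : finType) (x : J -> V -> V) n :
  (1 < p)%N -> finite_set (growth_set p x n).
Proof.
move=> p_gt1.
pose f (u : J * n.-bseq J * 'I_n.+1) :=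
  op_pow (rnorm_comm (x u.1.1) (map x u.1.2)) (p ^ u.2).
apply: (@sub_finite_set _ _ (range f)); last exact/finite_image/finite_finset.
move=> _ [j [s [l [le_n ->]]]].
have sz : (size s <= n)%N.
  apply: leq_trans le_n; rewrite (leq_trans (leqnSn _))//.
  by rewrite leq_pmulr// expn_gt0 ltnW.
have ln : (l < n.+1)%N.
  rewrite ltnS; apply: leq_trans le_n.
  by rewrite (leq_trans (ltnW (ltn_expl l p_gt1)))// leq_pmull.
by exists (j, Bseq sz, Ordinal ln).
Qed.

Lemma growth_homo (p : nat) (J : finType) (x : J -> V -> V) (m n : nat) :
  (1 < p)%N -> (m <= n)%N -> (growth p x m <= growth p x n)%N.
Proof.
move=> p_gt1 mn; apply: ldim_lspan_le; first exact: finite_growth_set.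
move=> _ [j [s [l [le_m ->]]]]; exists j, s, l.
by split=> //; exact: leq_trans mn.
Qed.

End Growth.

(** * Eventual properties and iterated logarithms *)

Lemma infinite_near (A P : set nat) :
  infinite_set A -> (\forall n \near \oo, P n) -> exists n, A n /\ P n.
Proof.
move=> infA [N _ NP].
have [n [An Nn]] := infinite_setN0 (infinite_setD infA (finite_II N)).
exists n; split=> //; apply: NP => /=.
by rewrite leqNgt; apply/negP.
Qed.

Section Real.
Context {R : realType}.
Implicit Types (A : set R) (a b x : R) (n q : nat).

Lemma ereal_sup_EFin_eq A x : 0 < x ->
  (forall y, 0 < y -> y < x -> A y) -> (forall y, A y -> y <= x) ->
  ereal_sup [set y%:E | y in A] = x%:E.
Proof.
move=> x0 subA ubA; apply/eqP; rewrite eq_le; apply/andP; split.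
  by apply: ge_ereal_sup => _ [y Ay <-]; rewrite lee_fin ubA.
apply/lee_subgt0Pr => e e0.
pose y := Num.max (x / 2) (x - e).
have [y0 yx] : 0 < y /\ y < x.
  by rewrite /y lt_max gt_max; split; [apply/orP; left|apply/andP; split]; lra.
apply: (@le_trans _ _ y%:E); first by rewrite -EFinB lee_fin le_max lexx orbT.
by apply: ereal_sup_ubound; exists y => //; exact: subA.
Qed.

Lemma gt1_ltr_powR x a b : 1 < x -> a < b -> x `^ a < x `^ b.
Proof.
move=> x1 ab; rewrite /powR gt_eqF ?(lt_trans ltr01)//.
by rewrite ltr_expR ltr_pM2r// ln_gt0.
Qed.

Lemma ln_le_mono x y : 0 < x -> x <= y -> ln x <= ln y.
Proof.
by move=> x0 xy; rewrite ler_ln// posrE// (lt_le_trans x0).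
Qed.

Lemma iter_lnS q n : iter_ln R q.+1 n = Num.max 1 (ln (iter_ln R q n)).
Proof. by []. Qed.

Lemma iter_ln_ge1 q n : (0 < n)%N -> 1 <= iter_ln R q n.
Proof.
by case: q => [|q] n0; rewrite ?ler1n// iter_lnS le_max lexx.
Qed.

Lemma iter_ln_gt0 q n : (0 < n)%N -> 0 < iter_ln R q n.
Proof. by move=> n0; rewrite (lt_le_trans ltr01)// iter_ln_ge1. Qed.

Lemma iter_ln_near_ge q x : \forall n \near \oo, x <= iter_ln R q n.
Proof.
elim: q x => [|q IH] x; first exact: nbhs_infty_ger.
apply: filterS (IH (expR x)) => n xn.
by rewrite iter_lnS le_max -[X in X <= ln _]expRK ln_le_mono ?expR_gt0 ?orbT.
Qed.

Lemma iter_ln_homo q m n : (0 < m)%N -> (m <= n)%N ->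
  iter_ln R q m <= iter_ln R q n.
Proof.
move=> m0 mn; elim: q => [|q IH]; first by rewrite ler_nat.
rewrite !iter_lnS ge_max !le_max lexx/= ln_le_mono ?orbT//.
exact: iter_ln_gt0.
Qed.

(** The induction closes because taking the logarithm turns the factor m into
    the summand ln m <= m - 1, and the iterated logarithm is at least 1. *)
Lemma iter_lnM_le q m n : (0 < m)%N -> (0 < n)%N ->
  iter_ln R q (m * n) <= m%:R * iter_ln R q n.
Proof.
move=> m0 n0; elim: q => [|q IH]; first by rewrite /iter_ln/= natrM.
have mR : 1 <= m%:R :> R by rewrite ler1n.
have L1 := iter_ln_ge1 q.+1 n n0.
have L0 := iter_ln_gt0 q n n0.
rewrite iter_lnS ge_max; apply/andP; split.
  by rewrite (le_trans L1)// ler_peMl// (le_trans ler01).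
have mn0 : (0 < m * n)%N by rewrite muln_gt0 m0.
have := ln_le_mono _ _ (iter_ln_gt0 q _ mn0) IH.
move=> /le_trans; apply.
rewrite lnM ?posrE ?ltr0n//.
have lnm : ln m%:R <= m%:R - 1 :> R.
  rewrite -[X in ln X](addrNK 1) addrC le_ln1Dx//; lra.
have lnL : ln (iter_ln R q n) <= iter_ln R q.+1 n.
  by rewrite iter_lnS le_max lexx orbT.
nra.
Qed.

Lemma iter_ln_le1 q n : (0 < q)%N -> (0 < n)%N -> iter_ln R q n <= iter_ln R 1 n.
Proof.
case: q => // q _ n0; elim: q => // q; apply: le_trans.
rewrite iter_lnS ge_max iter_ln_ge1// ltW// ln_sublinear//.
exact: iter_ln_gt0.
Qed.

(** As ln^(q) n <= L = ln n, it suffices that b ln L < a L, which holds once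
    sqrt L >= 2 b / a, because ln L = 2 ln (sqrt L) < 2 sqrt L. *)
Lemma iter_ln_powR_lt q a b : (0 < q)%N -> 0 < a -> 0 < b ->
  \forall n \near \oo, iter_ln R q n `^ b < n%:R `^ a.
Proof.
move=> q0 a0 b0; near=> n.
have n0 : (0 < n)%N by near: n; exact: nbhs_infty_gt.
have L0 := iter_ln_gt0 1 n n0.
(* Any bound above 1 forces ln n > 1, so that the maximum in L is ln n. *)
have : 2 <= iter_ln R 1 n by near: n; exact: iter_ln_near_ge.
have : (2 * b / a) ^+ 2 <= iter_ln R 1 n by near: n; exact: iter_ln_near_ge.
have := iter_ln_le1 _ _ q0 n0.
set L := iter_ln R 1 n in L0 *.
move=> LqL La L2.
have LE : L = ln n%:R.
  by move: L2; rewrite /L iter_lnS /= /Num.max; case: ifPn => // _; lra.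
have {}La : 2 * b <= a * Num.sqrt L.
  have x0 : 0 <= 2 * b / a by rewrite divr_ge0 ?mulr_ge0 ?ltW.
  by rewrite -ler_pdivrMl// mulrC -(ger0_norm x0) -sqrtr_sqr ler_sqrt // ltW.
have s0 : 0 < Num.sqrt L by rewrite sqrtr_gt0.
have lnL : ln L < 2 * Num.sqrt L.
  rewrite -[X in ln X](sqr_sqrtr (ltW L0)) lnXn// mulr2n.
  by have := ln_sublinear s0; lra.
apply: (@le_lt_trans _ _ (L `^ b)).
  by rewrite ge0_ler_powR ?nnegrE// ltW// iter_ln_gt0.
rewrite /powR !gt_eqF// ?ltr0n// ltr_expR -LE.
have LL : L = Num.sqrt L * Num.sqrt L by rewrite -expr2 sqr_sqrtr ?ltW.
apply: (@lt_le_trans _ _ (2 * b * Num.sqrt L)); first nra.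
by rewrite [in leRHS]LL mulrA ler_pM2r.
Unshelve. all: by end_near. Qed.

End Real.

(** * The three dimensions *)

Theorem corollary3p2 (R : realType) (p : nat) (K : fieldType)
    (charK : p \in [pchar K])
    (Theta : species 3) (S : fly Theta -> nat) (S_gt0 : forall a, (0 < S a)%N)
    (q : nat) (q_gt0 : (0 < q)%N) (kappa : R) (kappa_gt0 : 0 < kappa) :
  let lambda : R := logb 2 (p%:R - 1 / 2) in
  let gamma : nat -> R := fun n => (drosophila_growth K p S n)%:R in
  (forall eps delta : R, 0 < eps -> 0 < delta ->
     infinite_set [set n : nat |
       expR (n%:R / ln n%:R `^ (lambda + eps)) <= gamma n /\
       gamma n <= expR (delta * (n%:R / ln n%:R `^ lambda))]) ->
  (forall eps : R, 0 < eps ->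
     infinite_set [set n : nat |
       n%:R * iter_ln R q n `^ (kappa - eps) <= gamma n /\
       gamma n <= n%:R * iter_ln R q n `^ (kappa + eps)]) ->
  intermediate_growth gamma ->
  (forall eps delta : R, 0 < eps -> 0 < delta ->
     exists n0 : nat, forall n : nat, (n0 <= n)%N ->
       n%:R * iter_ln R q n `^ (kappa - eps) <= gamma n /\
       gamma n <= expR (delta * (n%:R / ln n%:R `^ lambda))) ->
  p_nil p (drosophila K p S) ->
  [/\ upper_Dim (@Phi4 R) gamma = (lambda^-1)%:E /\
        lambda^-1 = logb (p%:R - 1 / 2) 2,
      lower_Dim (@Phi2 R) gamma = 1%:E
    & lower_Ldim q gamma = kappa%:E].
Proof.
move=> lambda gamma hypA hypB _ hypC _.
have p_pr : prime p by apply: pcharf_prime charK.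
have p_gt1 : 2 <= p%:R :> R by rewrite ler_nat prime_gt1.
have lambda_gt0 : 0 < lambda by rewrite divr_gt0 ?ln_gt0//; lra.
have gamma_homo : {homo gamma : m n / (m <= n)%N >-> m <= n}.
  by move=> m n mn; rewrite ler_nat growth_homo// prime_gt1.
split; [split; last by rewrite /lambda /logb invf_div| |].
- apply/eqP; rewrite eq_le; apply/andP; split.
    apply: ereal_inf_lbound; exists lambda^-1 => //=.
    split; first by rewrite invr_gt0.
    have [N NP] := hypC 1 1 ltr01 ltr01.
    exists N => n Nn; have [_] := NP n Nn.
    by rewrite /Phi4 invrK mul1r.
  apply: le_ereal_inf_tmp => _ [alpha [alpha_gt0 [N NP]] <-].
  rewrite lee_fin leNgt; apply/negP => alpha_lt.
  have lt_alpha : lambda < alpha^-1.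
    by rewrite -[ltLHS]invrK ltf_pV2// posrE invr_gt0.
  pose eps := (alpha^-1 - lambda) / 2.
  have eps_gt0 : 0 < eps by rewrite /eps; lra.
  have large : \forall n \near \oo, (N <= n)%N /\ expR 2 <= n%:R :> R.
    by apply: filterI; [exact: nbhs_infty_ge|exact: nbhs_infty_ger].
  have [n [[gamma_ge _] [Nn n_ge]]] :=
    infinite_near _ _ (hypA eps 1 eps_gt0 ltr01) large.
  have n_gt0 : 0 < n%:R :> R by rewrite (lt_le_trans (expR_gt0 2)).
  have ln_n : 1 < ln n%:R :> R.
    rewrite (@lt_le_trans _ _ 2) ?ltr1n//.
    by rewrite -[leLHS]expRK ln_le_mono ?expR_gt0.
  have := le_trans gamma_ge (NP n Nn).
  rewrite /Phi4 ler_expR ler_pM2l// lef_pV2 ?posrE ?powR_gt0 ?(lt_trans ltr01)//.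
  by apply/negP; rewrite -ltNge gt1_ltr_powR// /eps; lra.
- apply: ereal_sup_EFin_eq => // [alpha alpha_gt0 alpha_lt1|alpha [alpha_gt0 [N NP]]].
    split=> //.
    have [N NP] := hypC kappa 1 kappa_gt0 ltr01.
    exists (maxn N 1) => n; rewrite geq_max => /andP[Nn n_gt0].
    have [+ _] := NP n Nn; rewrite subrr powRr0 mulr1; apply: le_trans.
    by rewrite ler1_powR ?ler1n// ltW.
  rewrite leNgt; apply/negP => alpha_gt1.
  have alpha1 : 0 < alpha - 1 by rewrite subr_gt0.
  have kk : 0 < kappa + kappa by rewrite addr_gt0.
  have large : \forall n \near \oo, (maxn N 1 <= n)%N /\
      iter_ln R q n `^ (kappa + kappa) < n%:R `^ (alpha - 1).
    by apply: filterI; [exact: nbhs_infty_ge|exact: iter_ln_powR_lt].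
  have [n [[_ gamma_le] []]] := infinite_near _ _ (hypB kappa kappa_gt0) large.
  rewrite geq_max => /andP[Nn n_gt0] n_lt.
  have := le_trans (NP n Nn) gamma_le; apply/negP; rewrite -ltNge /Phi2.
  have -> : n%:R `^ alpha = n%:R * n%:R `^ (alpha - 1) :> R.
    rewrite -[X in _ = X * _]powRr1 ?ler0n// -powRD ?subrKC//.
    by rewrite pnatr_eq0 -lt0n n_gt0 implybT.
  by rewrite ltr_pM2l ?ltr0n.
- apply: ereal_sup_EFin_eq => // [beta beta_gt0 beta_lt|beta [beta_gt0 [N [C]]]].
    split=> //.
    have eps_gt0 : 0 < kappa - beta by rewrite subr_gt0.
    have [N NP] := hypC (kappa - beta) 1 eps_gt0 ltr01.
    exists N.+1, 1%N; split=> // n Nn; rewrite mul1n.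
    by have [+ _] := NP n (ltnW Nn); rewrite subKr.
  move=> [N_gt0 C_gt0 NP].
  rewrite leNgt; apply/negP => beta_gt.
  pose eps := (beta - kappa) / 2.
  have eps_gt0 : 0 < eps by rewrite /eps; lra.
  have ke_gt0 : 0 < kappa + eps by rewrite addr_gt0.
  (* With n = floor(m / C) >= 1 one has m < C (n + 1) <= 2 C n. *)
  pose D := (2 * C)%N.
  have D_gt0 : (0 < D)%N by rewrite muln_gt0.
  (* The hypotheses at n and m will give L ^ eps <= B for L = ln^(q) n. *)
  pose B : R := D%:R * D%:R `^ (kappa + eps).
  have B_gt0 : 0 < B by rewrite mulr_gt0 ?powR_gt0 ?ltr0n.
  have [M _ MP] := iter_ln_near_ge q (B `^ eps^-1 + 1).
  have [m [[_ gamma_le] m_ge]] := infinite_near _ _ (hypB eps eps_gt0)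
    (nbhs_infty_ge (maxn M N * C)).
  pose n := (m %/ C)%N.
  have : (maxn M N <= n)%N by rewrite leq_divRL.
  rewrite geq_max => /andP[Mn Nn].
  have n_gt0 : (0 < n)%N := leq_trans N_gt0 Nn.
  have m_gt0 : (0 < m)%N.
    by apply: leq_trans m_ge; rewrite muln_gt0 C_gt0 leq_max N_gt0 orbT.
  have m_le : (m <= D * n)%N.
    have := ltn_ceil m C_gt0; rewrite -/n => /ltnW/leq_trans; apply.
    by rewrite /D mulnC -mulnA mulnCA leq_mul2l mul2n -addnn -addn1 leq_add2l n_gt0 orbT.
  have Cn_le : (C * n <= m)%N by rewrite mulnC leq_divM.
  have L_ge := MP n Mn; rewrite /= in L_ge.
  have L_gt0 := iter_ln_gt0 q n n_gt0 : 0 < iter_ln R q n.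
  set L := iter_ln R q n in L_ge L_gt0.
  have : n%:R * L `^ beta <= n%:R * (B * L `^ (kappa + eps)).
    apply: le_trans (NP n Nn) _; apply: le_trans (gamma_homo _ _ Cn_le) _.
    apply: le_trans gamma_le _.
    have -> : n%:R * (B * L `^ (kappa + eps)) =
        (D * n)%:R * (D%:R * L) `^ (kappa + eps).
      by rewrite powRM ?ler0n ?(ltW L_gt0)// natrM /B; ring.
    apply: ler_pM; rewrite ?powR_ge0 ?ler_nat//.
    have Lm_gt0 := iter_ln_gt0 q m m_gt0 : 0 < iter_ln R q m.
    apply: ge0_ler_powR; rewrite ?nnegrE ?mulr_ge0 ?ler0n//; try exact: ltW.
    apply: le_trans (iter_lnM_le q _ _ D_gt0 n_gt0).
    exact: iter_ln_homo.
  rewrite ler_pM2l ?ltr0n// -[beta](subrKC (kappa + eps)).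
  rewrite (@powRD _ _ (kappa + eps)); last by rewrite (gt_eqF L_gt0) implybT.
  rewrite mulrC ler_pM2r ?powR_gt0//; apply/negP; rewrite -ltNge.
  have -> : beta - (kappa + eps) = eps by rewrite /eps; lra.
  rewrite -[ltLHS]powRr1 ?ltW// -(mulVf (lt0r_neq0 eps_gt0)) powRrM.
  by rewrite gt0_ltr_powR ?nnegrE ?powR_ge0 ?ltW//; lra.
Qed.
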